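(* Let $w=[w_{i,j}]_{1\le i\le m,\,1\le j\le n}$ be an HV-palindrome of size $(m,n)$ with $m,n\ge 1$. Put $k=\lfloor m/2\rfloor$ and $l=\lfloor n/2\rfloor$. Let $u$ be the prefix of $w$ of size $(k,l)$, i.e. $u=[w_{i,j}]_{1\le i\le k,\,1\le j\le l}$, with rows $u_1,\dots,u_k$. Let $v$ be the array of size $(k,l)$ whose rows are $u_1^R,\dots,u_k^R$ (the 1D reversals of the rows of $u$). Let $p_1=w_{1,\lceil n/2\rceil}w_{2,\lceil n/2\rceil}\cdots w_{k,\lceil n/2\rceil}$ (a 1D word), let $p_1^T$ denote the column of height $k$ with these entries from top to bottom, let $p_2=w_{\lceil m/2\rceil,1}w_{\lceil m/2\rceil,2}\cdots w_{\lceil m/2\rceil,l}$ (a row of length $l$), and let $x=w_{\lceil m/2\rceil,\lceil n/2\rceil}$. Then, in block notation: (1) if $m$ and $n$ are even, $w=\begin{pmatrix} u & v\\ v^R & u^R\end{pmatrix}$; (2) if $m$ is even and $n$ is odd, $w=\begin{pmatrix} u & p_1^T & v\\ v^R & (p_1^T)^R & u^R\end{pmatrix}$; (3) if $m$ is odd and $n$ is even, $w=\begin{pmatrix} u & v\\ p_2 & p_2^R\\ v^R & u^R\end{pmatrix}$; (4) if $m$ and $n$ are odd, $w=\begin{pmatrix} u & p_1^T & v\\ p_2 & x & p_2^R\\ v^R & (p_1^T)^R & u^R\end{pmatrix}$.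
   Context: A 2D word of size $(m,n)$ over a finite alphabet $\Sigma$ is an $m\times n$ array $w=[w_{i,j}]$ with entries in $\Sigma$. Its rows are the 1D words $w_{i,1}\cdots w_{i,n}$ and its columns are $w_{1,j}\cdots w_{m,j}$. A 1D word is a palindrome if it equals its reversal. The reverse of a 2D word $w$ of size $(m,n)$ is $w^R=[w_{m-i+1,\,n-j+1}]_{i,j}$ (rotation by $180^\circ$); for a 1D row or column this is the usual reversal. A 2D word is an HV-palindrome if each of its rows and each of its columns is a 1D palindrome. The prefix of $w$ of size $(a,b)$ is its top-left $a\times b$ sub-array. Block notation $\begin{pmatrix}A&B\\C&D\end{pmatrix}$ denotes the array obtained by placing the blocks side by side (column concatenation) and on top of each other (row concatenation); blocks having a zero dimension (which occur when $k=0$ or $l=0$) are simply omitted. *)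

(* Defs.v *)
From mathcomp Require Import all_boot all_algebra.
Set Implicit Arguments.
Unset Strict Implicit.
Unset Printing Implicit Defensive.

(* A 2D word of size (m, n) over Sigma is a matrix 'M[Sigma]_(m, n), with
   0-based indices; a 1D word is a matrix with a single row ('rV) or a single
   column ('cV).  Only the type-generic part of the matrix library is used. *)

Section TwoDimWords.
Variable Sigma : Type.

(* Rotation by 180 degrees; on 'rV and 'cV it is the usual 1D reversal. *)
Definition wrev m n (w : 'M[Sigma]_(m, n)) : 'M[Sigma]_(m, n) :=
  \matrix_(i, j) w (rev_ord i) (rev_ord j).

Definition palindrome m n (w : 'M[Sigma]_(m, n)) : Prop := w = wrev w.

Definition HV_palindrome m n (w : 'M[Sigma]_(m, n)) : Prop :=
  (forall i : 'I_m, palindrome (row i w)) /\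
  (forall j : 'I_n, palindrome (col j w)).

Definition prefix2 m n a b (ha : a <= m) (hb : b <= n)
    (w : 'M[Sigma]_(m, n)) : 'M[Sigma]_(a, b) :=
  mxsub (widen_ord ha) (widen_ord hb) w.

End TwoDimWords.

Lemma leq_half_self m : m./2 <= m.
Proof. by rewrite leq_half_double -addnn; apply: leq_trans (leq_addr m m) _. Qed.

Lemma mid_subproof m (hm : 0 < m) : (uphalf m).-1 < m.
Proof. by case: m hm => //= m _; rewrite ltnS leq_half_self. Qed.

(* The 1-based index ceil(m / 2), shifted to a 0-based one. *)
Definition mid m (hm : 0 < m) : 'I_m := Ordinal (mid_subproof hm).

(* Used with castmx to identify the size of a block array with that of w. *)
Lemma even_split m : ~~ odd m -> m./2 + m./2 = m.
Proof. by move=> /negbTE om; rewrite addnn -[RHS]odd_double_half om. Qed.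

Lemma odd_split m : odd m -> m./2 + (1 + m./2) = m.
Proof. by move=> om; rewrite addnCA addnn -[RHS]odd_double_half om. Qed.

(* Main.v *)
Require Import Defs.
From mathcomp Require Import all_boot all_algebra.
From mathcomp Require Import zify.

(** An HV-palindrome is fixed by the reflections [i -> m-1-i] of the rows and [j -> n-1-j] of the
    columns, so its top-left quadrant and middle lines determine it. Here [v] is the left-right
    mirror of [u], [wrev v] the top-bottom mirror and [wrev u] both at once. Each block entry is
    thus an entry of [w] at an equal or mirrored position, and [HV_palindrome_sym] reduces the
    theorem to index arithmetic. *)

Lemma HV_palindrome_sym (Sigma : Type) m n (w : 'M[Sigma]_(m, n))
    (i i' : 'I_m) (j j' : 'I_n) :
  HV_palindrome w -> (i == i' :> nat) || (i + i' == m.-1) ->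
  (j == j' :> nat) || (j + j' == n.-1) -> w i j = w i' j'.
Proof.
move=> [rowP colP] hi hj.
have row_sym a b : w a b = w a (rev_ord b).
  by have /matrixP/(_ 0%R b) := rowP a; rewrite !mxE.
have col_sym a b : w a b = w (rev_ord a) b.
  by have /matrixP/(_ a 0%R) := colP b; rewrite !mxE.
have ord_sym p (a a' : 'I_p) :
    (a == a' :> nat) || (a + a' == p.-1) -> a' = a \/ a' = rev_ord a.
  (* The bounds force [p > 0], so the truncated [p.-1] agrees with the value [p - a.+1] of
     [rev_ord a]. *)
  move=> h; have := ltn_ord a; have := ltn_ord a'.
  by case/orP: h => /eqP h *; [left | right]; apply: val_inj => /=; lia.
by case: (ord_sym _ _ _ hi) => ->; case: (ord_sym _ _ _ hj) => ->;
  rewrite -?col_sym -?row_sym.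
Qed.

Theorem theorem3p1 (Sigma : finType) (m n : nat) (hm : 0 < m) (hn : 0 < n)
    (w : 'M[Sigma]_(m, n)) (hw : HV_palindrome w) :
  let k := m./2 in
  let l := n./2 in
  let u : 'M[Sigma]_(k, l) := prefix2 (leq_half_self m) (leq_half_self n) w in
  let v : 'M[Sigma]_(k, l) := (\matrix_(i < k) wrev (row i u))%R in
  let p1 : 'rV[Sigma]_k := (\row_(i < k) w (widen_ord (leq_half_self m) i) (mid hn))%R in
  let p2 : 'rV[Sigma]_l := (\row_(j < l) w (mid hm) (widen_ord (leq_half_self n) j))%R in
  let x : 'M[Sigma]_(1, 1) := const_mx (w (mid hm) (mid hn)) in
  [/\ forall (em : ~~ odd m) (en : ~~ odd n),
        w = castmx (even_split em, even_split en)
              (col_mx (row_mx u        v)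
                      (row_mx (wrev v) (wrev u))),
      forall (em : ~~ odd m) (on : odd n),
        w = castmx (even_split em, odd_split on)
              (col_mx (row_mx u        (row_mx (p1^T)%R        v))
                      (row_mx (wrev v) (row_mx (wrev (p1^T)%R) (wrev u)))),
      forall (om : odd m) (en : ~~ odd n),
        w = castmx (odd_split om, even_split en)
              (col_mx (row_mx u  v)
              (col_mx (row_mx p2 (wrev p2))
                      (row_mx (wrev v) (wrev u))))
    & forall (om : odd m) (on : odd n),
        w = castmx (odd_split om, odd_split on)
              (col_mx (row_mx u        (row_mx (p1^T)%R        v))
              (col_mx (row_mx p2       (row_mx x               (wrev p2)))
                      (row_mx (wrev v) (row_mx (wrev (p1^T)%R) (wrev u)))))].
Proof.
move=> k l u v p1 p2 x; rewrite /u /v /p1 /p2 /x /k /l.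
by split=> ? ?; apply/matrixP => i j; rewrite castmxE;
  do ![rewrite !mxE; case: splitP => -[? ?] /= ?]; rewrite !mxE;
  (* Both conditions are now equations in [nat], settled by parity: for even [m], rows [k + i] and
     [k - 1 - i] are mirrored; for odd [m], [(uphalf m).-1] is [k], the offset of the middle row.
     Columns behave likewise. *)
  apply: HV_palindrome_sym => //=;
  lia.
Qed.
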